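(* Let $G$ be a graph with at least one edge. Then $$a(G)-\alpha(G)\leq\min\left\{\Gamma(\mu(G)),\,a(G)-\operatorname{res}(G)\right\}.$$ Moreover, writing $\Delta=\Delta(G)$, one has the exact identity $$a(G)-\operatorname{res}(G)=\frac{(\Delta-1)a(G)-2\sigma_\Delta(G)}{\Delta+1}-\bigl(\operatorname{res}(G)-W(G)\bigr).$$ Denoting the right-hand side of this identity by $\Theta_{\mathrm{GR}}(G)$, consequently $$a(G)-\alpha(G)\leq\min\{\Gamma(\mu(G)),\Theta_{\mathrm{GR}}(G)\}.$$ In particular, if $a(G)-\alpha(G)=\Gamma(\mu(G))$, then $$(\Delta(G)+1)\,\Gamma(\mu(G))\leq(\Delta(G)-1)a(G)-2\sigma_\Delta(G)-(\Delta(G)+1)\bigl(\operatorname{res}(G)-W(G)\bigr).$$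
   Context: All graphs are finite, simple and undirected. For a graph $G$ with $m(G)\geq1$ edges, degree sequence $d_1\leq\cdots\leq d_n$ and maximum degree $\Delta=\Delta(G)$: $\alpha(G)$ is the independence number, $\mu(G)$ is the matching number, the annihilation number is $a=a(G)=\max\{k : \sum_{i=1}^k d_i\leq m(G)\}$, and the Caro–Wei sum is $W(G)=\sum_{i=1}^n\frac{1}{d_i+1}$. Put $\Gamma(0)=0$ and $\Gamma(\mu)=2\mu+1-\lceil\sqrt{6\mu}\rceil$ for integers $\mu\geq 1$. With $S_H(G)=\sum_{i=1}^{a}d_i$, define $$\sigma_\Delta(G)=\frac{\Delta(n-a)-S_H(G)}{2\Delta}+\sum_{i=1}^{a}\frac{(\Delta-d_i)(\Delta-d_i-1)}{2\Delta(d_i+1)}+\sum_{i=a+1}^{n}\frac{\Delta-d_i}{2(d_i+1)} .$$ The Havel–Hakimi residue $\operatorname{res}(G)$: starting from the degree sequence in non-increasing order, repeatedly delete the first (largest) term $d$, subtract $1$ from each of the next $d$ terms, and re-sort in non-increasing order, until all remaining terms are $0$; $\operatorname{res}(G)$ is the number of zeros remaining. *)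

(* Defs.v *)
From HB Require Import structures.
From mathcomp Require Import all_boot all_order all_algebra.
From mathcomp Require Import reals.

Set Implicit Arguments.
Unset Strict Implicit.
Unset Printing Implicit Defensive.

Import Order.TTheory GRing.Theory Num.Theory.

(* A finite simple graph is a symmetric irreflexive [e : rel T] on a finType;
   these two hypotheses are carried by the theorem, not by the definitions. *)

Section Graph.
Variables (T : finType) (e : rel T).

Definition degree (x : T) : nat := #|[set y | e x y]|.

Definition max_degree : nat := \max_(x : T) degree x.

Definition edges : {set {set T}} :=
  [set E : {set T} | [exists x, exists y, e x y && (E == [set x; y])]].

Definition nb_edges : nat := #|edges|.

Definition independent (S : {set T}) : bool :=
  [forall x in S, forall y in S, ~~ e x y].

Definition independence_number : nat :=
  \max_(S : {set T} | independent S) #|S|.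

Definition matching (M : {set {set T}}) : bool :=
  (M \subset edges) && trivIset M.

Definition matching_number : nat :=
  \max_(M : {set {set T}} | matching M) #|M|.

(* d_1 <= ... <= d_n, stored from index 0: d_i is entry i.-1. *)
Definition degree_seq : seq nat := sort leq [seq degree x | x <- enum T].

Definition annihilation_number : nat :=
  \max_(k < #|T|.+1 | sumn (take k degree_seq) <= nb_edges) k.

End Graph.

(* One step on a non-increasing sequence.  Predecessor is truncated at 0, which
   never happens on degree sequences of graphs. *)
Definition hh_step (s : seq nat) : seq nat :=
  if s is d :: s' then
    sort geq ([seq x.-1 | x <- take d s'] ++ drop d s')
  else [::].

(* Each step removes one term, so [size s] is enough fuel to reach a sequence
   of zeros. *)
Fixpoint hh_reduce (fuel : nat) (s : seq nat) : seq nat :=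
  if all (pred1 0) s then s
  else if fuel is fuel'.+1 then hh_reduce fuel' (hh_step s) else s.

Definition hh_residue (s : seq nat) : nat :=
  size (hh_reduce (size s) (sort geq s)).

Definition residue (T : finType) (e : rel T) : nat :=
  hh_residue (degree_seq e).

Local Open Scope ring_scope.

(* [R] only serves to interpret the square root; the value is an integer. *)
Definition Gamma (R : realType) (mu : nat) : int :=
  if mu == 0%N then 0
  else (2 * mu + 1)%:Z - Num.ceil (Num.sqrt ((6 * mu)%:R : R)).

Section Sums.
Variables (R : realType) (T : finType) (e : rel T).

Let n := #|T|.
Let a := annihilation_number e.
Let d (i : nat) : R := (nth 0%N (degree_seq e) i)%:R.
Let Delta : R := (max_degree e)%:R.

Definition caro_wei : R := \sum_(0 <= i < n) 1 / (d i + 1).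

Definition S_H : R := \sum_(0 <= i < a) d i.

Definition sigma_Delta : R :=
  (Delta * (n%:R - a%:R) - S_H) / (2 * Delta)
  + \sum_(0 <= i < a)
      (Delta - d i) * (Delta - d i - 1) / (2 * Delta * (d i + 1))
  + \sum_(a <= i < n) (Delta - d i) / (2 * (d i + 1)).

Definition Theta_GR : R :=
  ((Delta - 1) * a%:R - 2 * sigma_Delta) / (Delta + 1)
  - ((residue e)%:R - caro_wei).

End Sums.

(* Main.v *)
Require Import Defs.
From HB Require Import structures.
From mathcomp Require Import all_boot all_order all_algebra.
From mathcomp Require Import reals.
From mathcomp Require Import zify ring lra.

Set Implicit Arguments.
Unset Strict Implicit.
Unset Printing Implicit Defensive.

Import Order.TTheory GRing.Theory Num.Theory.

(* The identity is termwise: 2 sigma_Delta = (Delta + 1) W - 2 a.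

   For a - alpha <= Gamma(mu), let H be the a vertices of smallest degree and B
   the b others; the definition of a gives e(H) <= e(B).  Deleting vertices of
   degree at least 2 from H until a matching is left yields
   2 (a - alpha) <= mu(H) + e(H), while e(B) <= C(b,2) - floor(b/2) + mu(B), so
   2 (a - alpha) <= mu + C(b,2) - floor(b/2).  Also a - alpha <= 2 mu - b, since
   the vertices missed by a maximum matching are independent.  The first bound
   settles b <= s - 2 and the second one b >= s - 1, where s = ceil(sqrt(6 mu)).

   For res <= alpha, delete a vertex v of maximum degree.  The degree sequence of
   G - v is turned into the Havel-Hakimi successor of that of G by unit transfers
   towards smaller terms, so it suffices that such transfers do not increase the
   residue.  In terms of the conjugate partition c_t = #{i : d_i > t}, a
   transfer moves one box; a step either keeps this relation, or (when the
   maximum drops) turns it into the addition of two boxes.  When the maximum M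
   grows under such an addition, the extra term decremented absorbs one box, and
   the relation is a transfer again provided that at least M + 2 terms are as
   large as the smaller raised one; this condition persists along the steps. *)

(** * Havel-Hakimi steps on conjugate partitions *)

(* Conjugate of the partition obtained from that of [z] by subtracting 1 from
   its [m] largest terms: among these, [minn m (z t.+1)] exceed [t.+1]. *)
Definition decr_top (m : nat) (z : nat -> nat) (t : nat) : nat :=
  minn m (z t.+1) + (z t - m).

Definition conj_tail (M : nat) (c : nat -> nat) (t : nat) : nat := c t - (t < M).

Definition conj_step (M : nat) (c : nat -> nat) : nat -> nat :=
  decr_top M (conj_tail M c).

Definition noninc (c : nat -> nat) : Prop := forall t t', t <= t' -> c t' <= c t.

(** For the conjugate of a sequence, [M] is the largest term of that sequence. *)
Definition first_zero (c : nat -> nat) (M : nat) : Prop :=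
  forall t, (c t == 0) = (M <= t).

(** A term [p + 1] drops to [p] while a term [q <= p] rises to [q + 1]. The case [q = p] leaves the
    partition unchanged. *)
Definition box_transfer (c c' : nat -> nat) : Prop :=
  exists p q, q <= p /\ forall t, c' t + (t == p) = c t + (t == q).

(* Two terms, possibly the same, are raised: p (from p to p + 1) and q <= p.  The
   last condition says that at least M + 2 terms are >= q, so when M is the
   maximum, [q] can be chosen among the terms that the step does not touch. *)
Definition box_pair_added (M : nat) (c c' : nat -> nat) : Prop :=
  exists p q, [/\ q <= p <= M, forall t, c' t = c t + (t == p) + (t == q)
                & q = 0 \/ M + 2 <= c q.-1].

(** A term raised from [p] becomes number [z p + 1] in decreasing order. If that is at most [m], the
    term is among those decremented and its box shifts down by one column. *)
Definition box_moved (m : nat) (z : nat -> nat) (p : nat) : nat :=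
  if m <= z p then p else p.-1.

(** The side condition excludes raising a zero that then falls among the [m] decremented terms,
    where its box would be lost. *)
Lemma decr_top_add m z z' p :
    (forall t, z' t = z t + (t == p)) -> 0 < p \/ m <= z 0 ->
  forall t, decr_top m z' t = decr_top m z t + (t == box_moved m z p).
Proof.
move=> zz' hp t; rewrite /decr_top !zz' /box_moved.
case: p hp {zz'} => [|p] hp; first by have [->|] := eqVneq t 0; case: ifP; lia.
have [->|e1] := eqVneq t p; first by case: ifP; lia.
by have [->|e2] := eqVneq t p.+1; case: ifP; lia.
Qed.

(** The extra term decremented is the [m.+1]-th largest. The bounds on [z r] and [z r.+1] say that
    it equals [r + 1], so its decrement removes a box of column [r]. *)
Lemma decr_top_pred m z M : noninc z -> m < z 0 -> z M = 0 ->
  exists r, [/\ m < z r, z r.+1 <= m &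
    forall t, decr_top m z t = decr_top m.+1 z t + (t == r)].
Proof.
move=> zn z0 zM.
have ex : exists k, z k <= m by exists M; rewrite zM.
case: (ex_minnP ex) => -[|r] hr rmin; first by lia.
have mr : m < z r by rewrite ltnNge; apply/negP => /rmin; lia.
exists r; split=> // t; rewrite /decr_top.
case: (ltngtP t r) => htr.
- have h1 := zn t.+1 r htr; have h2 := zn t r (ltnW htr); lia.
- have h1 := zn r.+1 t htr; have h2 := zn r.+1 t.+1 (leqW htr); lia.
- subst; lia.
Qed.


Lemma first_zero_pos c M t : first_zero c M -> t < M -> 0 < c t.
Proof. by move=> cM; rewrite lt0n cM ltnNge. Qed.

Lemma first_zero_eq0 c M t : first_zero c M -> M <= t -> c t = 0.
Proof. by move=> cM Mt; apply/eqP; rewrite cM. Qed.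

Lemma first_zero_lt c M t : first_zero c M -> 0 < c t -> t < M.
Proof. by move=> cM; rewrite lt0n cM ltnNge. Qed.

Lemma first_zero_le c M t : first_zero c M -> c t = 0 -> M <= t.
Proof. by move=> cM h; rewrite -cM h. Qed.

Lemma first_zero_uniq c c' M M' : c =1 c' -> first_zero c M -> first_zero c' M' -> M = M'.
Proof.
move=> cc cM cM'; apply/eqP; rewrite eqn_leq.
rewrite (first_zero_le cM); last by rewrite cc (first_zero_eq0 cM').
by rewrite (first_zero_le cM') // -cc (first_zero_eq0 cM).
Qed.

Lemma noninc_tail d L : noninc d -> first_zero d L -> noninc (conj_tail L d).
Proof.
move=> dn dL t t' tt'; rewrite /conj_tail.
have h := dn _ _ tt'; have [lt|ge] := ltnP t' L; first lia.
by rewrite (first_zero_eq0 dL ge); lia.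
Qed.

Lemma noninc_decr m z : noninc z -> noninc (decr_top m z).
Proof.
move=> zn t t' tt'; rewrite /decr_top.
have := zn t t' tt'; have := zn t.+1 t'.+1 tt'; lia.
Qed.

Lemma eq_decr_top m z z' : z =1 z' -> decr_top m z =1 decr_top m z'.
Proof. by move=> zz t; rewrite /decr_top !zz. Qed.

(** * One step applied to two related conjugate partitions *)

Section Step.
Variables (M M' N : nat) (c c' : nat -> nat).
Hypotheses (cn : noninc c) (cn' : noninc c').
Hypotheses (cM : first_zero c M) (cM' : first_zero c' M').
Hypothesis (cN : first_zero (conj_step M c) N).
Hypothesis (good : M <= conj_tail M c 0).

(** Both tails arise from one partition [g] by adding a box, in column [p] or in column [q]. The
    step moves each box by [box_moved], which keeps their order. *)
Lemma conj_step_transfer_eq p q : M' = M -> q < p ->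
    (forall t, c' t + (t == p) = c t + (t == q)) ->
  box_transfer (conj_step M c) (conj_step M' c').
Proof.
move=> eqM qp cc; have cM'_ := cM'; rewrite eqM in cM'_ *.
have cp : c p = c' p + 1 by have := cc p; rewrite eqxx (gtn_eqF qp); lia.
have pM : p < M by apply: (first_zero_lt cM); lia.
have c'p := first_zero_pos cM'_ pM.
pose g t := conj_tail M c t - (t == p).
have e1 t : conj_tail M c t = g t + (t == p).
  rewrite /g /conj_tail; have [->|_] := eqVneq t p; lia.
have e2 t : conj_tail M c' t = g t + (t == q).
  have := cc t; rewrite /g /conj_tail; have [->|_] := eqVneq t p.
    by rewrite (gtn_eqF qp); lia.
  have [tM|Mt] := ltnP t M; last by rewrite (first_zero_eq0 cM Mt); lia.
  by have := first_zero_pos cM tM; lia.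
have g0 : 0 < q \/ M <= g 0.
  by right; rewrite /g (ltn_eqF (leq_ltn_trans (leq0n q) qp)) subn0.
exists (box_moved M g p), (box_moved M g q); split.
  by rewrite /box_moved; do 2![case: ifP => _]; lia.
move=> t; rewrite /conj_step (decr_top_add (m := M) e1) ?(decr_top_add (m := M) e2) //.
  lia.
by left; lia.
Qed.

(** The transfer lowers the only term equal to [M], so the tails differ by the box [q] alone. The
    step on [c'] decrements one term fewer, which leaves a second box, in column [r]. *)
Lemma conj_step_transfer_lt p q : M' < M -> q < p ->
    (forall t, c' t + (t == p) = c t + (t == q)) ->
  box_pair_added N (conj_step M c) (conj_step M' c').
Proof.
move=> ltM qp cc.
have cp : c p = c' p + 1 by have := cc p; rewrite eqxx (gtn_eqF qp); lia.
have pM : p < M by apply: (first_zero_lt cM); lia.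
have M1 : M.-1.+1 = M by lia.
have c'M1 : c' M.-1 = 0 by apply: (first_zero_eq0 cM'); lia.
have cM1 : 0 < c M.-1 by apply: (first_zero_pos cM); lia.
have pE : p = M.-1.
  by apply/eqP; have := cc M.-1; have [|] := eqVneq M.-1 p; lia.
have M'E : M' = M.-1.
  apply/eqP; rewrite eqn_leq; apply/andP; split; first lia.
  have : 0 < c' M.-2.
    have := cc M.-2; have := first_zero_pos cM (t := M.-2).
    by have [|] := eqVneq M.-2 p; lia.
  by move/(first_zero_lt cM'); lia.
set z := conj_tail M c; have good_ : M <= z 0 := good.
have zE t : z t = c t - (t < M) by [].
have zn : noninc z by apply: noninc_tail.
have zM1 : z M.-1 = 0 by move: c'M1; rewrite zE -pE; lia.
have zM : z M = 0 by apply/eqP; rewrite -leqn0 -zM1; apply: zn (leq_pred _).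
have e2 t : conj_tail M' c' t = z t + (t == q).
  have := cc t; rewrite zE M'E /conj_tail; have [->|tp] := eqVneq t p.
    by rewrite (gtn_eqF qp); lia.
  have [tM|Mt] := ltnP t M; last by rewrite (first_zero_eq0 cM Mt); lia.
  by have := first_zero_pos cM tM; lia.
have [|r [rz r1z rE]] := @decr_top_pred M.-1 z M zn _ zM; first lia.
rewrite M1 in rz rE.
have s2 := decr_top_add (m := M.-1) e2.
set q' := box_moved M.-1 z q in s2.
have st t : conj_step M' c' t = decr_top M z t + (t == r) + (t == q').
  by rewrite /conj_step {1}M'E s2 ?rE //; right; lia.
set d := decr_top M z in st.
change (conj_step M c) with d.
have cN_ : first_zero d N := cN.
have dE t : d t = minn M (z t.+1) + (z t - M) by [].
have dn : noninc d by apply: noninc_decr.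
have dpos t : 0 < z t.+1 -> t < N.
  by move=> zt; apply: (first_zero_lt cN_); rewrite dE; lia.
have rN : r <= N by case: (r) rz => // k kz; apply: dpos; lia.
have q'N : q' <= N.
  rewrite /q' /box_moved; case: ifP => hq.
    by case: (q) qp hq => // k kp hk; apply: dpos; lia.
  case: (q) qp cc => [|[|k]] //= kp cc'; apply: dpos; rewrite zE.
  have := cc' k.+1; have := cc' k.+2; have := cn' (leqnSn k.+1).
  have := first_zero_pos cM (t := k.+2).
  rewrite eqxx (ltn_eqF kp) (ltn_eqF (ltnW kp)) (ltn_eqF (leqnn _)).
  lia.
(* Column [r.-1] of [d] has at least [M] boxes and [N <= M.-1], so only [N = M.-1] is critical. In
   that case more than [M] terms of the tail are at least [M.-1], which gives the missing unit. *)
have rC : r = 0 \/ N + 2 <= d r.-1.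
  have r_lt : r < M.-1 by rewrite ltnNge; apply/negP => /zn; lia.
  have N_le : N <= M.-1 by apply: (first_zero_le cN_); rewrite dE M1; lia.
  case: (r) rz r_lt => [|k] rz klt; [by left|right => /=].
  have zk := zn k k.+1 (leqnSn _); rewrite dE.
  have [NM|NM] := eqVneq N M.-1; last by lia.
  have : 0 < d M.-2 by apply: (first_zero_pos cN_); lia.
  have M2 : M.-2.+1 = M.-1 by lia.
  by rewrite dE M2 zM1; have := zn k M.-2; lia.
(* The condition bears on the smaller of the two columns, and [d] is larger towards 0. *)
case: (leqP q' r) => qr.
  exists r, q'; split=> //; first by rewrite qr.
  case: rC => [|rC]; first by lia.
  case: (posnP q') => [|q'0]; [by left|right].
  by apply: leq_trans rC (dn _ _ _); lia.
exists q', r; split=> //; first by rewrite ltnW.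
by move=> t; rewrite st addnAC.
Qed.

Lemma conj_step_transfer : box_transfer c c' ->
  M' <= conj_tail M' c' 0 /\
  (box_transfer (conj_step M c) (conj_step M' c') \/
   box_pair_added N (conj_step M c) (conj_step M' c')).
Proof.
case=> p [q [qp cc]].
move: qp; rewrite leq_eqVlt => /orP[/eqP qpE|qp].
  have ccE : c' =1 c by move=> t; have := cc t; rewrite qpE; lia.
  have MM := first_zero_uniq ccE cM' cM.
  have tE : conj_tail M' c' =1 conj_tail M c by move=> t; rewrite /conj_tail ccE MM.
  split; first by rewrite tE MM.
  left; exists 0, 0; split=> // t.
  by rewrite /conj_step (eq_decr_top M' tE) MM.
have cp : c p = c' p + 1 by have := cc p; rewrite eqxx (gtn_eqF qp); lia.
have pM : p < M by apply: (first_zero_lt cM); lia.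
have M'M : M' <= M.
  apply: (first_zero_le cM'); have := cc M.
  by rewrite (first_zero_eq0 cM (leqnn _)) !gtn_eqF //; lia.
split.
  have := cc 0; rewrite (ltn_eqF (leq_ltn_trans (leq0n _) qp)).
  by move: good; rewrite /conj_tail; lia.
by have [|eqM] := eqVneq M' M; [left|right];
   [apply: conj_step_transfer_eq cc | apply: conj_step_transfer_lt cc; rewrite // ltn_neqAle eqM].
Qed.

(** Deleting the new maximum [M + 1] absorbs the box in column [M], so the tail gains only the box
    [q]. One more term is decremented, which removes a box of column [r]; the result is a transfer
    from [r]. *)
Lemma conj_step_pair_top q : q <= M ->
    (forall t, c' t = c t + (t == M) + (t == q)) ->
    q = 0 \/ M + 2 <= c q.-1 ->
  M' <= conj_tail M' c' 0 /\ box_transfer (conj_step M c) (conj_step M' c').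
Proof.
move=> qM cc cq.
have cM0 := first_zero_eq0 cM (leqnn M).
have M'E : M' = M.+1.
  apply/eqP; rewrite eqn_leq; apply/andP; split.
    apply: (first_zero_le cM').
    by rewrite cc (first_zero_eq0 cM (leqnSn _)) !gtn_eqF // ltnS.
  by apply: (first_zero_lt cM'); rewrite cc cM0 eqxx.
have cM'_ := cM'; rewrite M'E in cM'_ *.
set z := conj_tail M c; have good_ : M <= z 0 := good.
have zE t : z t = c t - (t < M) by [].
have e2 t : conj_tail M.+1 c' t = z t + (t == q).
  rewrite zE /conj_tail cc; case: (ltngtP t M) => tM.
  - by have := first_zero_pos cM tM; lia.
  - by rewrite (first_zero_eq0 cM (ltnW tM)); lia.
  - by rewrite tM; lia.
have z'0 : M < conj_tail M.+1 c' 0.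
  rewrite e2; case: cq => [->|cq]; first by rewrite eqxx; lia.
  by rewrite zE; have := cn (leq0n q.-1); lia.
split=> //.
have zn' : noninc (conj_tail M.+1 c') by apply: noninc_tail.
have z'M : conj_tail M.+1 c' M.+1 = 0.
  by rewrite /conj_tail (first_zero_eq0 cM'_).
have [r [rz r1z rE]] := decr_top_pred zn' z'0 z'M.
exists r, (box_moved M z q); split; last first.
  by move=> t; rewrite /conj_step -rE (decr_top_add (m := M) e2) //; right.
(* As [r] is the last column with more than [M] boxes, it suffices that the moved box lies in such a
   column. If it has shifted down, this is the bound on [c q.-1]. *)
have : M < conj_tail M.+1 c' (box_moved M z q).
  rewrite e2 /box_moved; case: ifP => hq; first by rewrite eqxx; lia.
  case: cq => [q0|cq]; first by rewrite q0 in hq; lia.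
  by rewrite zE; lia.
by case: (leqP (box_moved M z q) r) => // h; have := zn' _ _ h; lia.
Qed.

(** The maximum stays [M], and the boxes pass through the step one after the other, via [z1]. What
    remains is that the new columns are at most [N] and that the condition on the smaller one
    persists. *)
Lemma conj_step_pair_low p q : q <= p -> p < M ->
    (forall t, c' t = c t + (t == p) + (t == q)) ->
    q = 0 \/ M + 2 <= c q.-1 ->
  M' <= conj_tail M' c' 0 /\ box_pair_added N (conj_step M c) (conj_step M' c').
Proof.
move=> qp pM cc cq.
have M'E : M' = M.
  apply/eqP; rewrite eqn_leq; apply/andP; split.
    apply: (first_zero_le cM'); rewrite cc (first_zero_eq0 cM (leqnn M)).
    by rewrite !gtn_eqF // (leq_ltn_trans qp).
  rewrite leqNgt; apply/negP => h.
  by have := first_zero_pos cM h; have := cc M'; rewrite (first_zero_eq0 cM' (leqnn _)); lia.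
have cM'_ := cM'; rewrite M'E in cM'_ *.
set z := conj_tail M c; have good_ : M <= z 0 := good.
have zE t : z t = c t - (t < M) by [].
split; first by rewrite /conj_tail cc; move: good_; rewrite zE; lia.
have zn : noninc z by apply: noninc_tail.
pose z1 t := z t + (t == q).
have e1 t : z1 t = z t + (t == q) by [].
have e2 t : conj_tail M c' t = z1 t + (t == p).
  rewrite e1 zE /conj_tail cc; case: (ltnP t M) => tM; last by lia.
  by have := first_zero_pos cM tM; lia.
set q' := box_moved M z q; set p' := box_moved M z1 p.
have st t : conj_step M c' t = decr_top M z t + (t == p') + (t == q').
  rewrite /conj_step (decr_top_add (m := M) e2) ?(decr_top_add (m := M) e1); first by rewrite addnAC.
    by right.
  by right; rewrite e1; lia.
set d := decr_top M z in st.
change (conj_step M c) with d.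
have cN_ : first_zero d N := cN.
have dE t : d t = minn M (z t.+1) + (z t - M) by [].
have cq1 : 0 < q -> c q < c q.-1.
  move=> q0; have := cn' (leq_pred q); rewrite !cc eqxx.
  rewrite (ltn_eqF (_ : q.-1 < p)) 1?(ltn_eqF (_ : q.-1 < q)); lia.
have M1 : M.-1.+1 = M by lia.
have NM : N <= M.
  by apply: (first_zero_le cN_); rewrite dE !zE !(first_zero_eq0 cM) ?minn0.
(* If [N = M], a term [M] survives the step, so at least [M + 1] terms besides the deleted one equal
   [M]. *)
have NM1 : N = M -> M + 2 <= c M.-1.
  move=> NE; have := first_zero_pos cN_ (t := M.-1).
  by rewrite dE !zE M1 (first_zero_eq0 cM (leqnn _)); lia.
exists p', q'; split; last 2 first.
- exact: st.
(* An unmoved box has [M <= z q], and [cq1] makes column [q.-1] strictly longer. A box moved to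
   [q.-1] relies on [cq], and [N = M] is then impossible. *)
- rewrite /q' /box_moved; case: ifP => hq.
    case: (posnP q) => [|q0]; [by left|right].
    move: hq (cq1 q0); rewrite dE (prednK q0) !zE => hq cqq.
    have [NE|NE] := eqVneq N M; last by lia.
    have := cn (t := q) (t' := M.-1); have := NM1 NE; lia.
  have q0 : 0 < q by case: (q) hq => //; move: good_; lia.
  case: (posnP q.-1) => [|q10]; [by left|right].
  move: hq; rewrite dE (prednK q10) !zE => hq.
  have NE : N != M.
    by apply/eqP => /NM1; have := cn (t := q) (t' := M.-1); lia.
  have := cn (leq_pred q.-1); lia.
have dpos t : 0 < z t.+1 \/ M < z t -> t < N.
  by move=> zt; apply: (first_zero_lt cN_); rewrite dE; lia.
apply/andP; split.
  rewrite /q' /p' /box_moved /z1; move: qp; rewrite leq_eqVlt => /orP[/eqP->|qp].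
    by rewrite eqxx; case: ifP; case: ifP; lia.
  by case: ifP => _; case: ifP => _; lia.
rewrite /p' /box_moved /z1; case: ifP => hp.
  case: (p) pM hp => [//|k] kM hk; apply: dpos; left; lia.
case: (p) pM qp cc => [//|[//|k]] kM qk cc' /=; apply: dpos.
have := cn' (leqnSn k.+1); rewrite !cc' eqxx (ltn_eqF (leqnn k.+2)) !zE.
have [qE|qE] := eqVneq q k.+1; last first.
  by left; have := first_zero_pos cM kM; lia.
by rewrite qE /= in cq; right; lia.
Qed.

Lemma conj_step_pair_added : box_pair_added M c c' ->
  M' <= conj_tail M' c' 0 /\
  (box_transfer (conj_step M c) (conj_step M' c') \/
   box_pair_added N (conj_step M c) (conj_step M' c')).
Proof.
case=> p [q [/andP[qp]]]; rewrite leq_eqVlt => /orP[/eqP pM cc cq|pM cc cq].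
  by subst p; have [? ?] := conj_step_pair_top qp cc cq; split=> //; left.
by have [? ?] := conj_step_pair_low qp pM cc cq; split=> //; right.
Qed.

End Step.

(** * The residue is at most the independence number *)

Definition conj_seq (s : seq nat) (t : nat) : nat := count (fun x => t < x) s.

Lemma geq_trans : transitive geq.
Proof. by move=> y x z /= xy yz; apply: leq_trans yz xy. Qed.

Lemma geq_total : total geq.
Proof. by move=> x y; apply: leq_total. Qed.

Lemma geq_anti : antisymmetric geq.
Proof. by move=> x y; rewrite /= andbC => /anti_leq. Qed.

Lemma sorted_geq_sort (s : seq nat) : sorted geq (sort geq s).
Proof. exact: (sort_sorted geq_total). Qed.

Lemma sorted_geq_cons x s : sorted geq (x :: s) -> all (fun y => y <= x) s /\ sorted geq s.
Proof. by rewrite /= (path_sortedE geq_trans) => /andP[]. Qed.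

Lemma count_geq_bound x t s : all (fun y => y <= x) s -> x <= t -> conj_seq s t = 0.
Proof.
move=> /allP sx xt; apply/eqP; rewrite -leqn0 leqNgt -has_count.
by apply/hasPn => y /sx yx; rewrite -leqNgt (leq_trans yx).
Qed.

Lemma conj_seq_take s m t : sorted geq s -> conj_seq (take m s) t = minn m (conj_seq s t).
Proof.
elim: s m => [|x s IHs] [|m] ss; rewrite ?min0n ?minn0 //.
have [xs {}ss] := sorted_geq_cons ss.
rewrite /= /conj_seq /= -!/(conj_seq _ t) IHs //.
by have [|xt] := ltnP t x; [lia | rewrite (count_geq_bound xs xt)]; lia.
Qed.

Lemma conj_seq_first_zero s : sorted geq s -> first_zero (conj_seq s) (head 0 s).
Proof.
case: s => [|x s] ss t //=; have [xs _] := sorted_geq_cons ss.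
rewrite /conj_seq /= -/(conj_seq s t).
by have [xt|] := leqP x t; [rewrite (count_geq_bound xs xt)|]; lia.
Qed.

Lemma conj_seq_noninc s : noninc (conj_seq s).
Proof. by move=> t t' tt'; apply: sub_count => x /=; apply: leq_ltn_trans. Qed.

Lemma conj_tail_cons x s : conj_tail x (conj_seq (x :: s)) =1 conj_seq s.
Proof. by move=> t; rewrite /conj_tail /conj_seq /= addKn. Qed.

Lemma conj_seq_hh_step s : sorted geq s ->
  conj_seq (hh_step s) =1 conj_step (head 0 s) (conj_seq s).
Proof.
case: s => [|m s] ss t; first by rewrite /conj_step /decr_top /conj_tail /conj_seq /=; lia.
have [_ {}ss] := sorted_geq_cons ss.
rewrite /conj_step (eq_decr_top _ (@conj_tail_cons m s)) /decr_top.
rewrite /conj_seq count_sort count_cat count_map.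
have -> : count (preim predn (fun x => t < x)) (take m s) = conj_seq (take m s) t.+1.
  by apply: eq_count => x /=; lia.
rewrite conj_seq_take //; congr (_ + _).
have := congr1 (conj_seq^~ t) (cat_take_drop m s).
have := conj_seq_take m t ss; rewrite /conj_seq count_cat /=; lia.
Qed.

Lemma hh_step_sorted s : sorted geq (hh_step s).
Proof. by case: s => //= m s; apply: sorted_geq_sort. Qed.

Lemma size_hh_step s : size (hh_step s) = (size s).-1.
Proof.
by case: s => //= m s; rewrite size_sort size_cat size_map -size_cat cat_take_drop.
Qed.

Lemma size_hh_reduce f s : size (hh_reduce f s) <= size s.
Proof.
elim: f s => [|f IHf] s /=; first by case: ifP.
by case: ifP => // _; apply: leq_trans (IHf _) _; rewrite size_hh_step leq_pred.
Qed.

Lemma conj_seq_all0 s : all (pred1 0) s <-> conj_seq s 0 = 0.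
Proof.
rewrite /conj_seq; split.
  by elim: s => //= x s IHs /andP[/eqP-> /IHs].
move/eqP; rewrite -leqn0 leqNgt -has_count -all_predC.
by apply: sub_all => x /=; lia.
Qed.

(* The first term is at most the number of positive terms after it, so the
   truncated predecessors in [hh_step] are never taken at 0. *)
Definition can_step (s : seq nat) : Prop :=
  head 0 s <= conj_tail (head 0 s) (conj_seq s) 0.

(** This is required at every step of the run, and it is passed on from [s] to [s'] together with
    the comparison of residues. *)
Definition reducible (s : seq nat) : Prop := forall i, can_step (iter i hh_step s).

Definition conj_related (s s' : seq nat) : Prop :=
  box_transfer (conj_seq s) (conj_seq s') \/
  box_pair_added (head 0 s) (conj_seq s) (conj_seq s').

Lemma eq_box_transfer c1 c2 c1' c2' : c1 =1 c2 -> c1' =1 c2' ->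
  box_transfer c1 c1' -> box_transfer c2 c2'.
Proof.
move=> e e' [p [q [qp h]]]; exists p, q; split=> // t.
by rewrite -e -e' h.
Qed.

Lemma eq_box_pair_added M c1 c2 c1' c2' : c1 =1 c2 -> c1' =1 c2' ->
  box_pair_added M c1 c1' -> box_pair_added M c2 c2'.
Proof.
move=> e e' [p [q [qp h hq]]]; exists p, q; split=> // [t|].
  by rewrite -e -e' h.
by rewrite -e.
Qed.

Lemma conj_related_step s s' : sorted geq s -> sorted geq s' -> can_step s ->
  conj_related s s' -> can_step s' /\ conj_related (hh_step s) (hh_step s').
Proof.
move=> ss ss' gs rs.
have e := conj_seq_hh_step ss; have e' := conj_seq_hh_step ss'.
have zN : first_zero (conj_step (head 0 s) (conj_seq s)) (head 0 (hh_step s)).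
  by move=> t; rewrite -e; apply: conj_seq_first_zero (hh_step_sorted s) t.
have z := conj_seq_first_zero ss; have z' := conj_seq_first_zero ss'.
have n := @conj_seq_noninc s; have n' := @conj_seq_noninc s'.
have [gs' rs'] := or_ind (conj_step_transfer n n' z z' zN gs)
  (conj_step_pair_added n n' z z' zN gs) rs.
split=> //; case: rs' => rs'; [left|right].
  by apply: eq_box_transfer rs' => t; rewrite ?e ?e'.
by apply: eq_box_pair_added rs' => t; rewrite ?e ?e'.
Qed.

(** Thus [s] reaches zeros no later than [s'] and loses no more terms, which is what orders the
    residues. *)
Lemma conj_related_all0 s s' : conj_related s s' ->
  all (pred1 0) s' -> all (pred1 0) s.
Proof.
move=> rs /conj_seq_all0 s'0; apply/conj_seq_all0.
case: rs => [[p [q [qp h]]]|[p [q [_ h _]]]]; last first.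
  by have := h 0; lia.
have n0 t : conj_seq s' t = 0.
  by apply/eqP; rewrite -leqn0 -s'0; apply: conj_seq_noninc.
by have := h q; have := h 0; rewrite !n0 eqxx; lia.
Qed.

Lemma conj_related_residue s s' : sorted geq s -> sorted geq s' -> size s = size s' ->
  reducible s -> conj_related s s' ->
  reducible s' /\ forall f, size (hh_reduce f s') <= size (hh_reduce f s).
Proof.
move=> ss ss' sz gs rs; split.
  move=> i; elim: i s s' ss ss' sz gs rs => [|i IHi] s s' ss ss' sz gs rs.
    by have [] := conj_related_step ss ss' (gs 0) rs.
  have [_ rs'] := conj_related_step ss ss' (gs 0) rs.
  rewrite iterSr; apply: (IHi (hh_step s)) rs'; rewrite ?hh_step_sorted ?size_hh_step ?sz //.
  by move=> k; rewrite -iterSr.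
move=> f; elim: f s s' ss ss' sz gs rs => [|f IHf] s s' ss ss' sz gs rs.
  by have E u : hh_reduce 0 u = u; [rewrite /=; case: ifP | rewrite !E sz].
(* If [s] consists of zeros, its residue is its size, which is also the size of [s']. *)
have := size_hh_reduce f.+1 s'; rewrite /= -sz; case: (ifP (all _ s)) => // s0 _.
case: ifP => s'0; first by rewrite (conj_related_all0 rs s'0) in s0.
have [_ rs'] := conj_related_step ss ss' (gs 0) rs.
apply: IHf => //; rewrite ?hh_step_sorted ?size_hh_step ?sz //.
by move=> k; rewrite -iterSr.
Qed.

Lemma reducible_all0 s : sorted geq s -> all (pred1 0) s -> reducible s.
Proof.
move=> ss s0 i; elim: i s ss s0 => [|i IHi] s ss s0.
  by case: s ss s0 => [|x s] //= _ /andP[/eqP-> _].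
rewrite iterSr; apply: IHi; first exact: hh_step_sorted.
apply/conj_seq_all0; rewrite conj_seq_hh_step //.
have n0 t : conj_seq s t = 0.
  apply/eqP; rewrite -leqn0.
  by move/conj_seq_all0: s0 => <-; apply: conj_seq_noninc.
by rewrite /conj_step /decr_top /conj_tail !n0 !sub0n minn0.
Qed.

(** * Exchanging the vertices whose degrees are lowered *)

Section Exchange.
Variables (T : finType) (S : {set T}) (d : T -> nat).

(** If [X] is the neighbourhood of a deleted vertex, this is the degree sequence that remains; if
    [X] holds the largest remaining terms, it is the Havel-Hakimi successor. *)
Definition decr_seq (X : {set T}) : seq nat :=
  sort geq [seq d w - (w \in X) | w <- enum S].

Lemma conj_decr_seq X t :
  conj_seq (decr_seq X) t = \sum_(w in S) (t < d w - (w \in X)).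
Proof.
rewrite /conj_seq /decr_seq count_sort count_map -sum1_count big_mkcond /= big_enum /=.
by apply: eq_bigr => w _; case: ifP.
Qed.

Lemma conj_decr_seq_swap (X : {set T}) i j : i \in S -> j \in S -> i \notin X -> j \in X ->
    0 < d j <= d i ->
  box_transfer (conj_seq (decr_seq X)) (conj_seq (decr_seq (i |: X :\ j))).
Proof.
move=> iS jS iX jX /andP[j0 ji].
have ij : j != i by apply: contraNneq iX => <-.
(* Term [i] falls to [(d i).-1], and term [j] rises from [(d j).-1], an exact predecessor since
   [d j] is positive. *)
exists (d i).-1, (d j).-1; split; first by lia.
move=> t; rewrite !conj_decr_seq.
pose F (Z : {set T}) := \sum_(w in S | (w != i) && (w != j)) (t < d w - (w \in Z)).
have E (Z : {set T}) : \sum_(w in S) (t < d w - (w \in Z)) =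
    (t < d i - (i \in Z)) + ((t < d j - (j \in Z)) + F Z).
  rewrite (bigD1 i iS) (bigD1 j) /=; last exact/andP.
  by congr (_ + (_ + _)); apply: eq_bigl => w; rewrite -andbA.
have -> : \sum_(w in S) (t < d w - (w \in X)) =
    (t < d i) + ((t < (d j).-1) + F X) by rewrite E (negbTE iX) jX subn0 subn1.
rewrite E !in_setU1 !in_setD1 !eqxx (negbTE ij) /= subn0 subn1.
have -> : F (i |: X :\ j) = F X.
  apply: eq_bigr => w /and3P[_ wi wj].
  by rewrite !in_setU1 !in_setD1 (negbTE wi) wj.
move: (F X) => k; lia.
Qed.

(** Induction on [#|X :\: Y|]: replacing [j] in [X :\: Y] by [i] in [Y :\: X] is a transfer and
    brings [X] closer to [Y]. *)
Lemma decr_seq_residue (X Y : {set T}) : X \subset S -> Y \subset S -> #|X| = #|Y| ->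
    (forall x, x \in X -> 0 < d x) ->
    (forall i j, i \in Y -> j \in S :\: Y -> d j <= d i) ->
    reducible (decr_seq X) ->
  reducible (decr_seq Y) /\
  forall f, size (hh_reduce f (decr_seq Y)) <= size (hh_reduce f (decr_seq X)).
Proof.
have [n] := ubnP #|X :\: Y|; elim: n X => // n IHn X.
rewrite ltnS => Xn XS YS XY X0 Ytop gX.
have [XY0|/set0Pn[j]] := eqVneq (X :\: Y) set0.
  have -> : Y = X; last by [].
  by apply/eqP; rewrite eq_sym eqEcard -setD_eq0 XY0 eqxx XY leqnn.
have YX : #|Y :\: X| = #|X :\: Y|.
  by have := cardsID Y X; have := cardsID X Y; rewrite setIC XY; lia.
rewrite inE => /andP[jY jX].
have /set0Pn[i] : Y :\: X != set0.
  by rewrite -card_gt0 YX card_gt0; apply/set0Pn; exists j; rewrite inE jY.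
rewrite inE => /andP[iX iY].
have iS := subsetP YS i iY; have jS := subsetP XS j jX.
have dji : 0 < d j <= d i by rewrite X0 //= Ytop // inE jY.
have rel : conj_related (decr_seq X) (decr_seq (i |: X :\ j)).
  by left; apply: conj_decr_seq_swap.
have [|||g1 r1] := conj_related_residue _ _ _ gX rel; rewrite ?sorted_geq_sort //.
  by rewrite !size_sort !size_map.
have cX : #|X| = #|X :\ j|.+1 by rewrite (cardsD1 j) jX.
have [|||||||g2 r2] := IHn (i |: X :\ j) => //.
- have : #|(i |: X :\ j) :\: Y| < #|X :\: Y|; last by lia.
  apply: proper_card; apply/properP; split.
    apply/subsetP => x; rewrite !inE => /andP[xY /orP[/eqP xi|/andP[_ ->]]]; last by rewrite xY.
    by rewrite xi iY in xY.
  exists j; rewrite !inE ?jX ?jY // eqxx /= orbF.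
  by apply/eqP => ji; rewrite ji iY in jY.
- by apply/subsetP => x; rewrite !inE => /orP[/eqP->|/andP[_ /(subsetP XS)]].
- rewrite cardsU1 !inE (negbTE iX) andbF -XY cX; lia.
- by move=> x; rewrite !inE => /orP[/eqP->|/andP[_ /X0]] //; lia.
by split=> // f; apply: leq_trans (r2 f) (r1 f).
Qed.

End Exchange.

(** * Deletion of a vertex of maximum degree *)

Section Residue.
Variables (T : finType) (e : rel T).
Hypotheses (e_sym : symmetric e) (e_irr : irreflexive e).

Definition degree_in (S : {set T}) (x : T) : nat := #|[set y in S | e x y]|.

Definition degree_in_seq (S : {set T}) : seq nat :=
  sort geq [seq degree_in S x | x <- enum S].

Lemma degree_in_seq_max (S : {set T}) (v : T) (ws : seq T) :
    v \in S -> (forall x, x \in S -> degree_in S x <= degree_in S v) ->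
    perm_eq ws (enum (S :\ v)) -> sorted (relpre (degree_in S) geq) ws ->
  degree_in_seq S = degree_in S v :: [seq degree_in S w | w <- ws].
Proof.
move=> vS vmax wsS wss; apply: (sorted_eq geq_trans geq_anti).
- exact: sorted_geq_sort.
- rewrite /= (path_sortedE geq_trans) sorted_map wss andbT.
  apply/allP => _ /mapP[w + ->] /=.
  by rewrite (perm_mem wsS) mem_enum inE => /andP[_ /vmax].
rewrite perm_sort -map_cons; apply: perm_map.
apply: uniq_perm; rewrite ?enum_uniq //.
  by rewrite /= (perm_uniq wsS) enum_uniq (perm_mem wsS) mem_enum !inE eqxx.
move=> x; rewrite mem_enum inE (perm_mem wsS) mem_enum !inE.
by have [->|] := eqVneq x v.
Qed.

Lemma hh_step_degree_in_seq (S : {set T}) (v : T) (ws : seq T) :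
    v \in S -> (forall x, x \in S -> degree_in S x <= degree_in S v) ->
    perm_eq ws (enum (S :\ v)) -> sorted (relpre (degree_in S) geq) ws ->
  hh_step (degree_in_seq S) =
  decr_seq (S :\ v) (degree_in S) [set x in take (degree_in S v) ws].
Proof.
move=> vS vmax wsS wss; rewrite (degree_in_seq_max vS vmax wsS wss) /decr_seq /=.
set m := degree_in S v; move: (degree_in S) => d.
apply/(perm_sortP geq_total geq_trans geq_anti).
have uws : uniq ws by rewrite (perm_uniq wsS) enum_uniq.
apply: perm_trans (perm_map _ wsS).
rewrite -[X in perm_eq _ (map _ X)](cat_take_drop m ws) map_cat.
rewrite -map_take -map_drop -map_comp.
have eq_perm (a b : seq nat) : a = b -> perm_eq a b by move=> ->.
apply: perm_cat; apply: eq_perm; apply/eq_in_map => w wm /=.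
  by rewrite inE wm subn1.
rewrite inE -[w \in take _ _]negbK.
move: uws; rewrite -[X in uniq X](cat_take_drop m ws) cat_uniq => /and3P[_ /hasPn h _].
by rewrite (h w wm) subn0.
Qed.

Lemma degree_in_seqD1 (S : {set T}) (v : T) : v \in S ->
  degree_in_seq (S :\ v) =
  decr_seq (S :\ v) (degree_in S) [set y in S | e v y].
Proof.
move=> vS; rewrite /degree_in_seq /decr_seq; congr sort; apply/eq_in_map => w.
rewrite mem_enum !inE => /andP[wv wS]; rewrite wS /= /degree_in.
have -> : [set y in S :\ v | e w y] = [set y in S | e w y] :\ v.
  by apply/setP => y; rewrite !inE andbA.
by rewrite [in RHS](cardsD1 v) inE vS e_sym addKn.
Qed.

(** The independent set found in [S :\ v] serves for [S], since [decr_seq_residue] compares the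
    Havel-Hakimi successor with the degree sequence of [S :\ v]. Reducibility joins the induction
    because this comparison requires it. *)
Lemma degree_in_residue n (S : {set T}) : #|S| = n ->
  reducible (degree_in_seq S) /\
  exists I : {set T}, [/\ I \subset S, independent e I &
    size (hh_reduce n (degree_in_seq S)) <= #|I|].
Proof.
elim: n S => [|n IHn] S Sn.
  have S0 : S = set0 by apply/eqP; rewrite -cards_eq0 Sn.
  have sE : degree_in_seq S = [::] by rewrite /degree_in_seq S0 enum_set0.
  rewrite sE; split; first exact: reducible_all0.
  by exists set0; rewrite sub0set cards0; split=> //; apply/forall_inP => x; rewrite inE.
have sS : size (degree_in_seq S) = n.+1 by rewrite size_sort size_map -cardE.
have [d0|/forall_inPn[u uS u0]] := boolP [forall x in S, degree_in S x == 0].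
  split.
    apply: reducible_all0 (sorted_geq_sort _) _.
    rewrite (perm_all _ (permEl (perm_sort _ _))).
    apply/allP => _ /mapP[x + ->]; rewrite mem_enum => xS.
    exact: (forall_inP d0).
  exists S; split=> //; last by rewrite Sn -[X in _ <= X]sS; apply: size_hh_reduce.
  apply/forall_inP => x xS; apply/forall_inP => y yS; apply/negP => exy.
  have := forall_inP d0 x xS; rewrite cards_eq0 => /eqP/setP/(_ y).
  by rewrite !inE yS exy.
have [v vS vmax] : exists2 v, v \in S & forall x, x \in S -> degree_in S x <= degree_in S v.
  by have [v vS vmax] := arg_maxnP (degree_in S) uS; exists v.
have v0 : 0 < degree_in S v by apply: leq_trans (vmax u uS); rewrite lt0n.
pose ws := sort (relpre (degree_in S) geq) (enum (S :\ v)).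
have wsS : perm_eq ws (enum (S :\ v)) by rewrite perm_sort.
have wss : sorted (relpre (degree_in S) geq) ws.
  by apply: sort_sorted => x y; apply: geq_total.
have uws : uniq ws by rewrite (perm_uniq wsS) enum_uniq.
have S'n : #|S :\ v| = n by move: Sn; rewrite (cardsD1 v) vS => -[].
have ws_n : size ws = n by rewrite (perm_size wsS) -cardE.
set m := degree_in S v in v0 *.
pose X := [set y in S | e v y]; pose Y := [set x in take m ws].
have Xm : #|X| = m by [].
have XS : X \subset S :\ v.
  apply/subsetP => y; rewrite !inE => /andP[-> evy]; rewrite andbT.
  by apply: contraTneq evy => ->; rewrite e_irr.
have YS : Y \subset S :\ v.
  apply/subsetP => y; rewrite inE => /mem_take.
  by rewrite (perm_mem wsS) mem_enum.
have mn : m <= n by rewrite -S'n -Xm subset_leq_card.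
have Ym : #|Y| = m.
  rewrite cardsE (card_uniqP _) ?take_uniq // size_take ws_n.
  by case: ltnP => // ?; apply/eqP; rewrite eqn_leq; apply/andP.
have X0 x : x \in X -> 0 < degree_in S x.
  rewrite inE => /andP[xS evx]; apply/card_gt0P; exists v.
  by rewrite inE vS e_sym.
have Ytop i j : i \in Y -> j \in (S :\ v) :\: Y -> degree_in S j <= degree_in S i.
  rewrite inE => iY; rewrite in_setD -[j \in S :\ v]mem_enum -(perm_mem wsS) inE => /andP[jY jS].
  have jd : j \in drop m ws.
    by move: jS; rewrite -{1}(cat_take_drop m ws) mem_cat (negbTE jY).
  move: wss; rewrite -(cat_take_drop m ws) sorted_pairwise; last first.
    by move=> y x z; apply: geq_trans.
  by rewrite pairwise_cat => /and3P[/allrelP h _ _]; apply: (h i j).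
have [gX [I [IS Iind Ires]]] := IHn _ S'n.
rewrite degree_in_seqD1 // in gX Ires.
have [|gY Yres] := decr_seq_residue XS YS _ X0 Ytop gX; first by rewrite Xm.
have step := hh_step_degree_in_seq vS vmax wsS wss.
rewrite -/m -/Y in step.
split.
  case=> [|i]; last by rewrite iterSr step.
  (* The [m] neighbours of [v] in [S] are other vertices of positive degree. *)
  rewrite /can_step /= (degree_in_seq_max vS vmax wsS wss) [head _ _]/= conj_tail_cons.
  rewrite /conj_seq count_map (permP wsS) -[X in X <= _]Xm.
  rewrite -size_filter cardE uniq_leq_size ?enum_uniq // => x.
  rewrite mem_enum mem_filter mem_enum => xX; rewrite (subsetP XS) // andbT.
  exact: X0.
exists I; split=> //; first by apply: subset_trans IS (subD1set _ _).
apply: leq_trans Ires; rewrite [hh_reduce n.+1 _]/=.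
case: ifP => [/allP s0|_]; last by rewrite step; apply: Yres.
have /s0 : m \in degree_in_seq S.
  by rewrite mem_sort; apply: map_f; rewrite mem_enum.
by rewrite /= -leqn0 leqNgt v0.
Qed.

Lemma degree_inT x : degree_in setT x = degree e x.
Proof. by rewrite /degree_in /degree; congr #|pred_of_set _|; apply/setP => y; rewrite !inE. Qed.

Lemma residue_le_independence_number : residue e <= independence_number e.
Proof.
have [_ [I [_ Iind Ires]]] := degree_in_residue (erefl #|[set: T]|).
apply: leq_trans (leq_bigmax_cond I Iind); apply: leq_trans Ires.
rewrite /residue /hh_residue /degree_in_seq /degree_seq size_sort size_map -cardE.
rewrite cardsT enum_setT -enumT.
rewrite (eq_map degree_inT).
have -> // : forall s, sort geq (sort leq s) = sort geq s.
by move=> s; apply/(perm_sortP geq_total geq_trans geq_anti); rewrite perm_sort.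
Qed.

End Residue.

(** * Annihilation and matching numbers *)

(** From [k] to [k + 1], the binomial grows by [k], while the half grows by at most 1, and by 0 when
    [k = 0]. *)
Lemma bin2_sub_half b k : b <= k -> 'C(b, 2) + k %/ 2 <= 'C(k, 2) + b %/ 2.
Proof.
move=> /subnK <-; elim: (k - b) => // d IHd.
rewrite addSn binS bin1; have := leq_addl d b; lia.
Qed.

Lemma mul2_bin2 k : 2 * 'C(k, 2) + k = k ^ 2.
Proof. by elim: k => // k IHk; rewrite binS bin1; lia. Qed.

Section Annihilation.
Variables (T : finType) (e : rel T).
Hypotheses (e_sym : symmetric e) (e_irr : irreflexive e).
Implicit Types (x y : T) (A B E H S : {set T}) (M : {set {set T}}).

Lemma edgesP E : reflect (exists x y, e x y /\ E = [set x; y]) (E \in edges e).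
Proof.
rewrite inE; apply: (iffP existsP) => [[x /existsP[y /andP[exy /eqP ->]]]|[x [y [exy ->]]]].
  by exists x, y.
by exists x; apply/existsP; exists y; rewrite exy eqxx.
Qed.

Lemma edge_neq x y : e x y -> x != y.
Proof. by apply: contraTneq => ->; rewrite e_irr. Qed.

Definition edges_in A : {set {set T}} := [set E in edges e | E \subset A].

Lemma edges_inD1 A x : x \in A -> #|edges_in A| = #|edges_in (A :\ x)| + degree_in e A x.
Proof.
move=> xA; rewrite -(cardsID [set E : {set T} | x \in E] (edges_in A)) addnC; congr (_ + _).
  apply: eq_card => E; rewrite !inE subsetD1.
  by rewrite andbC -!andbA; congr (_ && _).
rewrite /degree_in -(card_in_imset (f := fun y => [set x; y])); last first.
  move=> y z; rewrite !inE => /andP[_ exy] /andP[_ exz] /setP/(_ y).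
  by rewrite !inE eqxx orbT eq_sym (negbTE (edge_neq exy)) /= => /esym/eqP.
apply: eq_card => E; rewrite !inE -[in LHS]andbA; apply/idP/imsetP.
  case/and3P=> /existsP[a /existsP[b /andP[eab /eqP EE]]]; subst E.
  rewrite !inE subUset !sub1set => /andP[aA bA] /orP[] /eqP ?; subst x.
    by exists b; rewrite // inE bA.
  by exists a; rewrite 1?setUC // inE aA e_sym.
case=> y; rewrite inE => /andP[yA exy] ->.
rewrite subUset !sub1set xA yA !inE eqxx !andbT /=.
by apply/existsP; exists x; apply/existsP; exists y; rewrite exy eqxx.
Qed.

Lemma degree_in_sum A x : degree_in e A x = \sum_(y in A) e x y.
Proof.
rewrite /degree_in -sum1_card big_mkcond [RHS]big_mkcond /=; apply: eq_bigr => y _.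
by rewrite inE; case: (y \in A); case: (e x y).
Qed.

Lemma handshake_in A : \sum_(x in A) degree_in e A x = 2 * #|edges_in A|.
Proof.
have [n] := ubnP #|A|; elim: n A => // n IHn A; rewrite ltnS => An.
have [->|[x xA]] := set_0Vmem A.
  rewrite big_set0; apply/esym/eqP; rewrite muln_eq0 cards_eq0 /=.
  apply/set0Pn => -[E]; rewrite inE => /andP[/edgesP[a [b [_ ->]]]].
  by rewrite subUset sub1set inE.
rewrite (edges_inD1 xA) mulnDr -IHn; last by move: An; rewrite (cardsD1 x) xA.
have -> : \sum_(y in A) degree_in e A y =
    degree_in e A x + \sum_(y in A :\ x) (degree_in e (A :\ x) y + e y x).
  rewrite (big_setD1 x xA) /=; congr (_ + _); apply: eq_bigr => y _.
  by rewrite !degree_in_sum (big_setD1 x xA) /= addnC.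
rewrite big_split /=.
have -> : \sum_(y in A :\ x) e y x = degree_in e A x.
  rewrite degree_in_sum (big_setD1 x xA) /= e_irr add0n.
  by apply: eq_bigr => y _; rewrite e_sym.
lia.
Qed.

Lemma edges_in_setT : edges_in setT = edges e.
Proof. by apply/setP => E; rewrite !inE subsetT andbT. Qed.

Lemma handshake : \sum_x degree e x = 2 * nb_edges e.
Proof.
rewrite /nb_edges -edges_in_setT -handshake_in; apply: eq_big => x; rewrite ?inE //.
by rewrite degree_inT.
Qed.

(** With [f] edges between [H] and its complement [B], the hypothesis reads
    [2 e(H) + f <= e(H) + e(B) + f]. *)
Lemma edges_in_leC H : \sum_(x in H) degree e x <= nb_edges e ->
  #|edges_in H| <= #|edges_in (~: H)|.
Proof.
move=> Hm; have hs := handshake.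
have degE x : degree e x = degree_in e H x + degree_in e (~: H) x.
  rewrite -degree_inT !degree_in_sum (bigID (mem H)) /=; congr (_ + _).
    by apply: eq_bigl => y; rewrite inE.
  by apply: eq_bigl => y; rewrite !inE.
have sumE A : \sum_(x in A) degree e x =
    \sum_(x in A) degree_in e H x + \sum_(x in A) degree_in e (~: H) x.
  by rewrite -big_split; apply: eq_bigr => x _; rewrite degE.
have cross : \sum_(x in H) degree_in e (~: H) x = \sum_(x in ~: H) degree_in e H x.
  rewrite (eq_bigr (fun x => \sum_(y in ~: H) e x y)); last by move=> x _; rewrite degree_in_sum.
  rewrite exchange_big /=; apply: eq_bigr => y _; rewrite degree_in_sum.
  by apply: eq_bigr => x _; rewrite e_sym.
have tot : \sum_x degree e x = \sum_(x in H) degree e x + \sum_(x in ~: H) degree e x.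
  by rewrite (bigID (mem H)) /=; congr (_ + _); apply: eq_bigl => y; rewrite !inE.
have := sumE H; have := sumE (~: H); rewrite !handshake_in.
lia.
Qed.

Definition has_matching A k : Prop :=
  exists M, [/\ matching e M, cover M \subset A & #|M| = k].

Lemma has_matching0 A : has_matching A 0.
Proof.
exists set0; rewrite cards0 /matching sub0set /cover big_set0 sub0set; split=> //=.
by apply/trivIsetP => E F; rewrite inE.
Qed.

Lemma has_matchingS A B k : A \subset B -> has_matching A k -> has_matching B k.
Proof. by move=> AB [M [mM cM Mk]]; exists M; split=> //; apply: subset_trans AB. Qed.

Lemma has_matching_edge x y : e x y -> has_matching [set x; y] 1.
Proof.
move=> exy; exists [set [set x; y]]; rewrite cards1 /cover big_set1; split=> //.
rewrite /matching trivIset1 andbT sub1set; apply/edgesP; by exists x, y.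
Qed.

Lemma has_matchingU A B k l : [disjoint A & B] ->
  has_matching A k -> has_matching B l -> has_matching (A :|: B) (k + l).
Proof.
move=> AB [M [/andP[Me Mt] MA Mk]] [N [/andP[Ne Nt] NB Nl]].
have MN : [disjoint cover M & cover N].
  by apply: disjointWl MA _; apply: disjointWr NB _.
exists (M :|: N); split.
- by rewrite /matching subUset Me Ne trivIsetU.
- by rewrite /cover bigcup_setU; apply: setUSS.
apply/eqP; rewrite -Mk -Nl (leq_card_setU M N).
apply/pred0P => E /=; apply/negP => /andP[EM EN].
have /edgesP[x [y [_ EE]]] := subsetP Me E EM.
have xE : x \in E by rewrite EE !inE eqxx.
have xM : x \in cover M by apply/bigcupP; exists E.
by have := disjointFr MN xM; move/bigcupP => []; exists E.
Qed.

Lemma has_matching_le A k : has_matching A k -> k <= matching_number e.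
Proof. by move=> [M [mM _ <-]]; apply: (leq_bigmax_cond (F := fun M => #|M|)). Qed.

Lemma independentP A :
  reflect (forall x y, x \in A -> y \in A -> ~~ e x y) (independent e A).
Proof.
apply: (iffP forall_inP) => [h x y xA yA|h x xA]; first exact: (forall_inP (h x xA)).
by apply/forall_inP => y; apply: h.
Qed.

Lemma independent_or_edge A :
  independent e A \/ exists x y, [/\ x \in A, y \in A & e x y].
Proof.
have [|/forall_inPn[x xA /forall_inPn[y yA]]] := boolP (independent e A); [by left|].
by rewrite negbK => exy; right; exists x, y.
Qed.

Lemma cardsD2 A x y : x \in A -> y \in A -> e x y -> #|A| = #|A :\ x :\ y|.+2.
Proof.
move=> xA yA exy; rewrite (cardsD1 x) xA (cardsD1 y (A :\ x)) !inE yA eq_sym.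
by rewrite (edge_neq exy).
Qed.

Lemma has_matching_add A x y k : x \in A -> y \in A -> e x y ->
  has_matching (A :\ x :\ y) k -> has_matching A k.+1.
Proof.
move=> xA yA exy mk.
have -> : A = [set x; y] :|: A :\ x :\ y.
  apply/setP => z; rewrite !inE.
  have [->|_] := eqVneq z x; first by rewrite xA.
  by have [->|_] := eqVneq z y; first by rewrite yA orbT.
rewrite -add1n; apply: has_matchingU mk; last exact: has_matching_edge.
apply/pred0P => z /=; rewrite !inE.
by case: (z == x); case: (z == y).
Qed.

(** A greedy matching suffices: both ends of an edge are removed while there is one, and the
    vertices left are independent. *)
Lemma independent_matching A : exists S k,
  [/\ S \subset A, independent e S, has_matching A k & #|A| <= #|S| + 2 * k].
Proof.
have [n] := ubnP #|A|; elim: n A => // n IHn A; rewrite ltnS => An.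
have [Ai|[x [y [xA yA exy]]]] := independent_or_edge A.
  by exists A, 0; split=> //; [apply: has_matching0 | lia].
have cA := cardsD2 xA yA exy.
have [|S [k [SA Si mk le]]] := IHn (A :\ x :\ y); first by lia.
exists S, k.+1; split=> //; last by lia.
  by apply: subset_trans SA _; rewrite !subDset; apply: subset_trans (subsetUr _ _); rewrite subsetUr.
exact: has_matching_add mk.
Qed.

Lemma degree_in_lt A x : x \in A -> degree_in e A x < #|A|.
Proof.
move=> xA; apply: proper_card; apply/properP; split.
  by apply/subsetP => y; rewrite inE => /andP[].
by exists x; rewrite // inE e_irr andbF.
Qed.

(** Let [b = #|A|]. Removing both ends of an edge destroys at most [(b - 1) + (b - 2)] edges, which
    is exactly the drop of ['C(b, 2)]; the drop of [b %/ 2] by 1 is paid by the matching edge. *)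
Lemma edges_in_matching A : exists k,
  has_matching A k /\ #|edges_in A| + #|A| %/ 2 <= 'C(#|A|, 2) + k.
Proof.
have [n] := ubnP #|A|; elim: n A => // n IHn A; rewrite ltnS => An.
have [Ai|[x [y [xA yA exy]]]] := independent_or_edge A.
  exists 0; split; first exact: has_matching0.
  have -> : edges_in A = set0.
    apply/setP => E; rewrite inE [RHS]inE; apply/negP => /andP[/edgesP[x [y [exy ->]]]].
    rewrite subUset !sub1set => /andP[xA yA].
    by have /independentP/(_ x y xA yA) := Ai; rewrite exy.
  rewrite cards0 bin2; case: #|A| => [|[|[|m]]] //=; nia.
have cA := cardsD2 xA yA exy.
have [|k [mk le]] := IHn (A :\ x :\ y); first by lia.
exists k.+1; split; first exact: has_matching_add mk.
have yA' : y \in A :\ x by rewrite !inE yA eq_sym edge_neq.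
rewrite (edges_inD1 xA) (edges_inD1 yA').
have := degree_in_lt xA; have := degree_in_lt yA'.
have := cardsD1 x A; rewrite xA cA !binS !bin1 bin0; lia.
Qed.

(* Twice the vertex cover number is at most matching number plus number of
   edges: delete a vertex of degree at least 2 while there is one. *)
Lemma independent_matching_edges A : exists S k,
  [/\ S \subset A, independent e S, has_matching A k &
      2 * #|A| <= 2 * #|S| + k + #|edges_in A|].
Proof.
have [n] := ubnP #|A|; elim: n A => // n IHn A; rewrite ltnS => An.
have [/existsP[x /andP[xA dx]]|noA] := boolP [exists x, (x \in A) && (1 < degree_in e A x)].
  have cA := cardsD1 x A; rewrite xA /= in cA.
  have [|S [k [SA Si mk le]]] := IHn (A :\ x); first by lia.
  exists S, k; split=> //.
  - by apply: subset_trans SA (subD1set _ _).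
  - by apply: has_matchingS mk; apply: subD1set.
  by rewrite (edges_inD1 xA); lia.
have [Ai|[x [y [xA yA exy]]]] := independent_or_edge A.
  by exists A, 0; split=> //; [apply: has_matching0 | lia].
have cA := cardsD2 xA yA exy.
have [|S [k [SA Si mk le]]] := IHn (A :\ x :\ y); first by lia.
(* All degrees in [A] are now at most 1, so [y] is the only neighbour of [x] and [x] can join the
   independent set. *)
have x1 : [set z in A | e x z] = [set y].
  apply/eqP; rewrite eq_sym eqEcard sub1set inE yA exy cards1.
  move/existsPn/(_ x): noA; rewrite xA /= -leqNgt; exact.
have nx z : z \in S -> ~~ e x z.
  move=> /(subsetP SA); rewrite !inE => /and3P[zy _ zA].
  by apply: contraNN zy => exz; move/setP/(_ z): x1; rewrite !inE zA exz => <-.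
exists (x |: S), k.+1; split.
- rewrite subUset sub1set xA; apply: subset_trans SA _.
  by apply: subset_trans (subD1set _ _) (subD1set _ _).
- apply/independentP => a b; rewrite !inE => /orP[/eqP->|aS] /orP[/eqP->|bS].
  + by rewrite e_irr.
  + exact: nx.
  + by rewrite e_sym nx.
  + by move/independentP: Si; apply.
- exact: has_matching_add mk.
have xS : x \notin S by apply/negP => /(subsetP SA); rewrite !inE eqxx andbF.
rewrite cardsU1 xS (edges_inD1 xA) /degree_in x1 cards1.
have yA' : y \in A :\ x by rewrite !inE yA eq_sym edge_neq.
by rewrite (edges_inD1 yA'); lia.
Qed.

Lemma annihilation_set : exists H,
  #|H| = annihilation_number e /\ \sum_(x in H) degree e x <= nb_edges e.
Proof.
pose P (k : 'I_#|T|.+1) := sumn (take k (degree_seq e)) <= nb_edges e.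
(* The value [k = 0] qualifies, so the maximum is attained. *)
have P0 : 0 < #|P| by apply/card_gt0P; exists ord0; rewrite /in_mem /= /P /= take0.
have [k Pk ak] := eq_bigmax_cond (A := P) (fun k : 'I_#|T|.+1 => k : nat) P0.
rewrite /annihilation_number ak.
pose ws := sort (relpre (degree e) leq) (enum T).
have uws : uniq (take k ws) by rewrite take_uniq // sort_uniq enum_uniq.
exists [set x in take k ws]; split.
  by rewrite cardsE (card_uniqP uws) size_takel // size_sort -cardE -ltnS.
rewrite big_set -big_uniq //= -(big_map (degree e) xpredT id) /= -sumnE map_take.
by move: Pk; rewrite /in_mem /= /P /degree_seq sort_map.
Qed.

Lemma annihilation_bounds : exists b,
  annihilation_number e + b <= independence_number e + 2 * matching_number e /\
  2 * annihilation_number e + b %/ 2 <=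
    2 * independence_number e + matching_number e + 'C(b, 2).
Proof.
have [H [Ha Hm]] := annihilation_set.
exists #|~: H|; split.
  have [S [k [_ Si mk]]] := independent_matching setT.
  have := leq_bigmax_cond (F := fun S => #|S|) S Si.
  by rewrite -/(independence_number e); have := has_matching_le mk; have := cardsC H; rewrite cardsT; lia.
have [S [k [_ Si mk le]]] := independent_matching_edges H.
have [l [ml le']] := edges_in_matching (~: H).
(* The matchings found inside [H] and inside its complement unite, so [k + l] is at most the
   matching number. *)
have dH : [disjoint H & ~: H] by rewrite -setI_eq0 setICr.
have := has_matching_le (has_matchingU dH mk ml).
have := leq_bigmax_cond (F := fun S => #|S|) S Si.
rewrite -/(independence_number e).
have := edges_in_leC Hm; lia.
Qed.

Lemma annihilation_sqrt_bound s : (s.-1) ^ 2 < 6 * matching_number e ->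
  annihilation_number e + s <= independence_number e + 2 * matching_number e + 1.
Proof.
have [b [h1 h2]] := annihilation_bounds; move: h1 h2.
move: (annihilation_number e) (independence_number e) (matching_number e) => a al mu h1 h2 hs.
have [|bs] := leqP s b.+1; first lia.
have [k sk] : exists k, s = k + 2 by exists (s - 2); lia.
have bk : b <= k by lia.
have h3 := bin2_sub_half bk.
rewrite leqNgt; apply/negP => contra.
(* Doubled, this bounds [6 * mu] by [k ^ 2 + 3 * k - 2 * (k %/ 2)], which is at most [(k + 1) ^ 2],
   against [hs]. *)
have h4 : 3 * mu <= 'C(k, 2) + 2 * k - k %/ 2 by lia.
rewrite sk addn2 /= in hs.
have h5 := mul2_bin2 k.
have h6 : k.+1 ^ 2 = k ^ 2 + 2 * k + 1 by lia.
rewrite h6 in hs; lia.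
Qed.

Lemma annihilation_number_le_card : annihilation_number e <= #|T|.
Proof. by have [H [<- _]] := annihilation_set; apply: max_card. Qed.

Lemma max_degree_gt0 : 0 < nb_edges e -> 0 < max_degree e.
Proof.
move=> /card_gt0P[E /edgesP[x [y [exy _]]]].
by apply: leq_trans (leq_bigmax x); apply/card_gt0P; exists y; rewrite inE.
Qed.

End Annihilation.

(** * Passage to real numbers and the identity for [sigma_Delta] *)

Local Open Scope ring_scope.

(** This squares [c - 1 < sqrt m]; positivity of [m] gives [c >= 1], so the predecessor is exact. *)
Lemma ceil_sqrt_nat (R : realType) (m : nat) : (0 < m)%N ->
  exists s : nat, Num.ceil (Num.sqrt (m%:R : R)) = s%:Z /\ (s.-1 ^ 2 < m)%N.
Proof.
move=> m0; set c := Num.ceil _.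
have c0 : 0 < c by rewrite ceil_gt0 sqrtr_gt0 ltr0n.
have := ceilB1_lt (Num.sqrt (m%:R : R)); rewrite -/c.
case: c c0 => [[|s]|s] // _ cs; exists s.+1; split=> //=.
have {}cs : s%:R < Num.sqrt (m%:R : R) by move: cs; rewrite intrB -addn1 PoszD intrD addrK.
rewrite -(ltr_nat R) natrX -[ltRHS]sqr_sqrtr ?ler0n //.
by rewrite ltr_pXn2r ?nnegrE ?ler0n ?sqrtr_ge0.
Qed.

Lemma annihilation_le_Gamma (R : realType) (T : finType) (e : rel T) :
    symmetric e -> irreflexive e ->
  (annihilation_number e)%:R - (independence_number e)%:R
    <= (Gamma R (matching_number e))%:~R :> R.
Proof.
move=> e_sym e_irr; rewrite /Gamma; case: eqP => [mu0|/eqP mu0].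
  rewrite subr_le0 ler_nat.
  by have [b [+ _]] := annihilation_bounds e_sym e_irr; rewrite mu0; lia.
have [|s [-> s_lt]] := @ceil_sqrt_nat R (6 * matching_number e); first by lia.
have := annihilation_sqrt_bound e_sym e_irr s_lt.
rewrite -(ler_nat R) intrB -!pmulrn !natrD.
lra.
Qed.

(** By partial fractions in [d i + 1], each summand is [(D + 1) / 2] times a Caro-Wei term plus a
    remainder. The remainders [d i / (2 * D)] and [- 1 / 2] cancel the first fraction of
    [sigma_Delta], and the [- 1] of each index below [a] adds up to [- a]. *)
Lemma sigma_Delta_caro_wei (R : realType) (T : finType) (e : rel T) :
    (0 < max_degree e)%N -> (annihilation_number e <= #|T|)%N ->
  2 * sigma_Delta R e =
  ((max_degree e)%:R + 1) * caro_wei R e - 2 * (annihilation_number e)%:R.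
Proof.
move=> D0 an; rewrite /sigma_Delta /caro_wei /S_H.
set a := annihilation_number e in an *; set n := #|T| in an *.
set D : R := (max_degree e)%:R.
have {}D0 : D != 0 by rewrite pnatr_eq0 -lt0n.
pose d i : R := (nth 0%N (degree_seq e) i)%:R.
have d1 i : d i + 1 != 0 by rewrite /d natr1 pnatr_eq0.
rewrite (big_cat_nat (leq0n a) an) /=.
have -> : \sum_(0 <= i < a) (D - d i) * (D - d i - 1) / (2 * D * (d i + 1)) =
    (D + 1) / 2 * (\sum_(0 <= i < a) 1 / (d i + 1))
    + (\sum_(0 <= i < a) d i) / (2 * D) - a%:R.
  rewrite -[in a%:R](subn0 a) -(sumr_const_nat a 0 1) mulr_sumr mulr_suml -big_split -sumrB /=.
  by apply: eq_bigr => i _; field; rewrite D0 d1.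
have -> : \sum_(a <= i < n) (D - d i) / (2 * (d i + 1)) =
    (D + 1) / 2 * (\sum_(a <= i < n) 1 / (d i + 1)) - (n%:R - a%:R) / 2.
  rewrite -natrB // -(sumr_const_nat n a 1) mulr_sumr mulr_suml -sumrB /=.
  by apply: eq_bigr => i _; field; rewrite d1.
rewrite -/d; field; exact: D0.
Qed.

Theorem corollary7p6 (R : realType) (T : finType) (e : rel T)
    (e_sym : symmetric e) (e_irr : irreflexive e)
    (e_edge : (1 <= nb_edges e)%N) :
  let a : R := (annihilation_number e)%:R in
  let alpha : R := (independence_number e)%:R in
  let res : R := (residue e)%:R in
  let Delta : R := (max_degree e)%:R in
  let G : R := (Gamma R (matching_number e))%:~R in
  [/\ a - alpha <= Num.min G (a - res),
      a - res = ((Delta - 1) * a - 2 * sigma_Delta R e) / (Delta + 1)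
                - (res - caro_wei R e),
      a - alpha <= Num.min G (Theta_GR R e) &
      a - alpha = G ->
      (Delta + 1) * G <=
        (Delta - 1) * a - 2 * sigma_Delta R e
        - (Delta + 1) * (res - caro_wei R e)].
Proof.
move=> a alpha res Delta G.
have aG : a - alpha <= G by apply: annihilation_le_Gamma.
have ares : a - alpha <= a - res.
  by rewrite lerD2l lerN2 ler_nat residue_le_independence_number.
have sigmaE := sigma_Delta_caro_wei R (max_degree_gt0 e_edge)
  (annihilation_number_le_card e).
have D1 : Delta + 1 != 0 by rewrite /Delta natr1 pnatr_eq0.
have D0 : 0 <= Delta + 1 by rewrite /Delta natr1 ler0n.
have idE : a - res = ((Delta - 1) * a - 2 * sigma_Delta R e) / (Delta + 1)
                - (res - caro_wei R e).
  by rewrite sigmaE -/a -/Delta; field.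
split=> //.
- by rewrite le_min aG.
- by rewrite le_min aG /Theta_GR -idE.
(* With [G] replaced by [a - alpha], the claim is [ares] multiplied by [Delta + 1]. *)
move=> <-.
have -> : (Delta - 1) * a - 2 * sigma_Delta R e - (Delta + 1) * (res - caro_wei R e)
    = (Delta + 1) * (a - res) by rewrite sigmaE -/a -/Delta; ring.
exact: ler_wpM2l.
Qed.
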